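(* Let $G_1$ and $G_2$ be finite groups, let $K_1\leq Z(G_1)$ and $K_2\leq Z(G_2)$ be central subgroups, and let $\theta:G_1\to G_2$ be a group homomorphism whose restriction $\theta|_{K_1}:K_1\to K_2$ is an isomorphism (of $K_1$ onto $K_2$). Let $G$ be the corresponding central product of $G_1$ and $G_2$, i.e. $G=E/N$, where $E=G_1\times G_2$ and $N=\{(a,b)\in E: a\in K_1,\ b\in K_2,\ \theta(a)=b^{-1}\}$ (a central subgroup of $E$). If $B_0(G_1/K_1)=B_0(G_1)=B_0(G_2)=0$, then $B_0(G)=0$.
   Context: $Z(H)$ denotes the centre of a group $H$. For a finite group $H$, the Bogomolov multiplier of $H$ is $$B_0(H)=\bigcap_{A}\ker\{\mathrm{res}:H^2(H,\mathbb Q/\mathbb Z)\to H^2(A,\mathbb Q/\mathbb Z)\},$$ where $H$ acts trivially on $\mathbb Q/\mathbb Z$ and $A$ runs over all bicyclic subgroups of $H$ (a group is bicyclic if it is cyclic or a direct product of two cyclic groups). Equivalently, $A$ may run over all abelian subgroups of $H$. *)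

(* Defs.v *)
From HB Require Import structures.
From mathcomp Require Import boolp classical_sets.
From mathcomp Require Import all_boot all_order all_algebra.
From mathcomp Require Import all_fingroup all_solvable.
From mathcomp Require Import generic_quotient ring_quotient.

Set Implicit Arguments.
Unset Strict Implicit.
Unset Printing Implicit Defensive.

Import GRing.Theory.
Local Open Scope ring_scope.
Local Open Scope quotient_scope.

Definition int_in_rat : {pred rat} := fun q => q \is a Num.int.

Fact int_in_rat_zmod_closed : zmod_closed int_in_rat.
Proof. by split=> [|x y xZ yZ]; [exact: rpred0 | exact: rpredB]. Qed.

HB.instance Definition _ :=
  GRing.isZmodClosed.Build rat int_in_rat int_in_rat_zmod_closed.

Definition QmodZ : zmodType := Quotient.quot int_in_rat.

Section Cohomology.

Variable gT : finGroupType.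
Implicit Types (G A : {group gT}) (f : {ffun gT * gT -> QmodZ}).

(* Inhomogeneous 2-cochains on G are stored as functions on gT * gT that      *)
(* vanish outside G * G, in the same way as class functions in 'CF(G).        *)
Definition cocycle2 G : {pred {ffun gT * gT -> QmodZ}} := fun f =>
  [forall u, (u \notin setX G G) ==> (f u == 0)]
  && [forall x in G, forall y in G, forall z in G,
        f (y, z) + f (x, (y * z)%g) == f ((x * y)%g, z) + f (x, y)].

Lemma cocycle2P G f :
  reflect ((forall u, u \notin setX G G -> f u = 0) /\
           (forall x y z, x \in G -> y \in G -> z \in G ->
              f (y, z) + f (x, (y * z)%g) = f ((x * y)%g, z) + f (x, y)))
          (f \in cocycle2 G).
Proof.
apply: (iffP andP) => -[fG fC]; split.
- by move=> u uG; apply/eqP/(implyP (forallP fG u)).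
- by move=> x y z xG yG zG; apply/eqP;
    move/forall_inP/(_ x xG)/forall_inP/(_ y yG)/forall_inP/(_ z zG): fC.
- by apply/forallP=> u; apply/implyP=> uG; rewrite fG.
- apply/forall_inP=> x xG; apply/forall_inP=> y yG; apply/forall_inP=> z zG.
  exact/eqP/fC.
Qed.

Fact cocycle2_zmod_closed G : zmod_closed (cocycle2 G).
Proof.
split=> [|f g /cocycle2P[f0 fC] /cocycle2P[g0 gC]]; apply/cocycle2P; split.
- by move=> u _; rewrite ffunE.
- by move=> x y z _ _ _; rewrite !ffunE.
- by move=> u uG; rewrite !ffunE f0 ?g0 ?subrr.
- move=> x y z xG yG zG; rewrite !ffunE addrACA -opprD fC // gC //.
  by rewrite opprD addrACA.
Qed.

HB.instance Definition _ G := GRing.isZmodClosed.Build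
  {ffun gT * gT -> QmodZ} (cocycle2 G) (cocycle2_zmod_closed G).

Record Z2 G := MkZ2 { Z2val :> {ffun gT * gT -> QmodZ};
                      Z2valP : Z2val \in cocycle2 G }.

HB.instance Definition _ G := [isSub for @Z2val G].
HB.instance Definition _ G := [Choice of Z2 G by <:].
HB.instance Definition _ G := [SubChoice_isSubZmodule of Z2 G by <:].

Definition coboundary2 G : {pred Z2 G} := fun f : Z2 G =>
  `[< exists h : gT -> QmodZ,
      {in G &, forall x y, f (x, y) = h y - h (x * y)%g + h x} >].

Fact coboundary2_zmod_closed G : zmod_closed (@coboundary2 G).
Proof.
split=> [|f g /asboolP[h hE] /asboolP[k kE]]; apply/asboolP.
  by exists (fun=> 0) => x y _ _; rewrite subrr addr0 ffunE.
exists (fun x => h x - k x) => x y xG yG.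
by rewrite !ffunE hE // kE // opprD addrACA; congr (_ + _);
  rewrite opprD addrACA -opprD.
Qed.

HB.instance Definition _ G := GRing.isZmodClosed.Build
  (Z2 G) (@coboundary2 G) (@coboundary2_zmod_closed G).

(* Second cohomology of G with trivial coefficients in Q / Z. *)
Definition H2 G : zmodType := Quotient.quot (@coboundary2 G).

Lemma H2_pi_eq0 G (f : Z2 G) : (\pi_(H2 G) f == 0) = (f \in @coboundary2 G).
Proof. by rewrite -[f in RHS]subr0 Quotient.idealrBE raddf0. Qed.

Section Restriction.

Variables (G A : {group gT}) (sAG : A \subset G).

Definition res_fun f : {ffun gT * gT -> QmodZ} :=
  [ffun u => if u \in setX A A then f u else 0].

Fact res_cocycle (f : Z2 G) : res_fun f \in cocycle2 A.
Proof.
case: f => f /= /cocycle2P[f0 fC]; apply/cocycle2P; split=> [u|x y z xA yA zA].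
  by move/negPf=> uA; rewrite ffunE uA.
by rewrite !ffunE !in_setX !groupM ?xA ?yA ?zA //= fC // (subsetP sAG).
Qed.

Definition resZ (f : Z2 G) : Z2 A := MkZ2 (res_cocycle f).

Fact resZ_is_zmod_morphism : zmod_morphism resZ.
Proof.
move=> f g; apply/val_inj/ffunP=> u.
by rewrite !ffunE; case: ifP; rewrite ?subrr // !ffunE.
Qed.

HB.instance Definition _ :=
  GRing.isZmodMorphism.Build (Z2 G) (Z2 A) resZ resZ_is_zmod_morphism.

Definition res (c : H2 G) : H2 A := \pi_(H2 A) (resZ (repr c)).

Lemma res_pi (f : Z2 G) : res (\pi_(H2 G) f) = \pi_(H2 A) (resZ f).
Proof.
apply/eqP; rewrite /res -Quotient.idealrBE; apply/asboolP.
have /asboolP[h hE] : repr (\pi_(H2 G) f) - f \in @coboundary2 G.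
  by rewrite Quotient.idealrBE reprK.
exists h => x y xA yA; rewrite -hE ?(subsetP sAG) // -raddfB.
by rewrite [LHS]ffunE in_setX xA yA.
Qed.

Fact res_is_zmod_morphism : zmod_morphism res.
Proof.
by move=> a b; rewrite -[a]reprK -[b]reprK -raddfB !res_pi !raddfB.
Qed.

HB.instance Definition _ :=
  GRing.isZmodMorphism.Build (H2 G) (H2 A) res res_is_zmod_morphism.

End Restriction.

Definition bicyclic A : Prop :=
  cyclic A \/
  exists H K : {group gT}, [/\ cyclic H, cyclic K & (H \x K = A)%g].

(* Bogomolov multiplier: the intersection of the kernels of the restrictions. *)
Definition B0 G : set (H2 G) :=
  [set c | forall (A : {group gT}) (sAG : A \subset G),
             bicyclic A -> res sAG c = 0]%classic.

End Cohomology.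

Arguments B0 {gT} G _.

Section CentralProduct.

Variables (gT1 gT2 : finGroupType).
Variables (G1 K1 : {group gT1}) (G2 K2 : {group gT2}).
Variable theta : {morphism G1 >-> gT2}.

(* {(a, b) | a \in K1, b \in K2, theta a = b^-1}, identifying (k, 1) with     *)
(* (1, theta k) in the quotient.                                              *)
Definition amalgam : {set gT1 * gT2} :=
  [set u in setX K1 K2 | theta u.1 == (u.2^-1)%g].

Hypotheses (sK1Z : K1 \subset 'Z(G1)%g) (sK2Z : K2 \subset 'Z(G2)%g).

Lemma amalgam_group_set : group_set amalgam.
Proof.
have sK1G := subset_trans sK1Z (center_sub G1).
have cK2 : {in K2 &, commutative mulg}.
  move=> b d /(subsetP sK2Z)/centerP[_ cb] /(subsetP sK2Z)/centerP[dG _].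
  exact: cb.
apply/group_setP; split=> [|[a b] [c d]].
  by rewrite inE in_setX !group1 /= morph1 invg1.
rewrite !inE /= => /andP[/andP[aK bK] /eqP ab] /andP[/andP[cK dK] /eqP cd].
by rewrite !groupM //= morphM ?(subsetP sK1G) // ab cd -invMg cK2.
Qed.

Lemma amalgam_central : amalgam \subset 'Z(setX G1 G2)%g.
Proof.
apply/subsetP=> -[a b]; rewrite inE in_setX /= => /andP[/andP[aK bK] _].
have /centerP[aG ca] := subsetP sK1Z a aK.
have /centerP[bG cb] := subsetP sK2Z b bK.
apply/centerP; split; first by rewrite in_setX aG.
case=> x y; rewrite in_setX => /andP[xG yG].
by congr (_, _); [exact: ca | exact: cb].
Qed.

(* The quotient by a set is the quotient by the subgroup it generates; by     *)
(* amalgam_group_set, amalgam is already a group when K1 and K2 are central.  *)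
Definition amalgam_product : {group coset_of amalgam} :=
  (setX G1 G2 / amalgam)%G.

End CentralProduct.

Arguments amalgam_product {gT1 gT2} G1 K1 G2 K2 theta.

(* Main.v *)
(* For a cocycle f on a bicyclic group, being a coboundary means being        *)
(* symmetric on commuting pairs, so B0 G = 0 says that every cocycle on G     *)
(* that is symmetric on commuting pairs is a coboundary. Inflate such an f    *)
(* from G = E / N to E = G1 x G2: it is the coboundary of some h, which       *)
(* restricts to a morphism on N and kills the commutators of E lying in N.    *)
(* Put psi a = h (a, theta a^-1) on K1. If x, y in G1 have [x, y] in K1, then *)
(* ([x, y], theta [x, y]^-1) is the commutator in E of (x, theta y) and       *)
(* (y, theta x), so psi kills [x, y]. Hence the cocycle of G1 / K1 obtained   *)
(* by pushing out along psi is symmetric on commuting pairs, and as           *)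
(* B0 (G1 / K1) = 0 the morphism psi extends to some chi on G1. Then          *)
(* h - chi o fst is trivial on N, so it factors through G and splits f.       *)
Require Import Defs.
From HB Require Import structures.
From mathcomp Require Import boolp classical_sets.
From mathcomp Require Import all_boot all_order all_algebra.
From mathcomp Require Import all_fingroup all_solvable.
From mathcomp Require Import generic_quotient.

Set Implicit Arguments.
Unset Strict Implicit.
Unset Printing Implicit Defensive.

Import GRing.Theory.
Local Open Scope ring_scope.

(** As Q/Z is divisible, the vanishing of [B0] is the splitting property [sym_splits]
    ([B0_trivialP]), which passes to direct products ([sym_splits_setX]). A splitting [h] of the
    inflated cocycle descends to the central product once its restriction to [N] extends to a
    morphism on [E] ([splits_coset]). Commutators are the only obstruction to extending
    ([central_morph_extends]), and [h] kills those lying in [N] ([split_by_coset_commg]). The role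
    of [theta] is to make each commutator of [G1] lying in [K1] the first coordinate of a commutator
    of [E] lying in [N]. *)

(** * Normalised 2-cocycles and their splittings *)

Section FactorSets.

Variables (gT : finGroupType) (V : zmodType).
Implicit Types (f : gT -> gT -> V) (h : gT -> V) (A B G H K : {group gT}).

Definition factor_set (A : {set gT}) f : Prop := f 1%g 1%g = 0 /\
  {in A & &, forall x y z, f y z + f x (y * z)%g = f (x * y)%g z + f x y}.

Definition split_by (A : {set gT}) f h : Prop :=
  {in A &, forall x y, h (x * y)%g + f x y = h x + h y}.

Definition splits (A : {set gT}) f : Prop := exists h, split_by A f h.

Definition commuting_sym (A : {set gT}) f : Prop :=
  {in A &, forall x y, commute x y -> f x y = f y x}.

Lemma factor_set1r G f x : factor_set G f -> x \in G -> f x 1%g = 0.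
Proof.
move=> [f1 fC] xG; have := fC x 1%g 1%g xG (group1 G) (group1 G).
by rewrite !mulg1 f1 => /addIr.
Qed.

Lemma factor_set1l G f x : factor_set G f -> x \in G -> f 1%g x = 0.
Proof.
move=> [f1 fC] xG; have := fC 1%g 1%g x (group1 G) (group1 G) xG.
by rewrite !mul1g f1 => /addrI.
Qed.

Lemma factor_setS (A B : {set gT}) f :
  A \subset B -> factor_set B f -> factor_set A f.
Proof.
move=> /subsetP sAB [f1 fC]; split=> // x y z xA yA zA.
by apply: fC; apply: sAB.
Qed.

Lemma split_by1 G f h : factor_set G f -> split_by G f h -> h 1%g = 0.
Proof.
move=> [f1 _] /(_ _ _ (group1 G) (group1 G)); rewrite mulg1 f1.
by move/addrI.
Qed.

Lemma split_commuting_sym (A : {set gT}) f h :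
  split_by A f h -> commuting_sym A f.
Proof.
move=> hE x y xA yA cxy; apply: (addrI (h (x * y)%g)).
by rewrite hE // cxy hE // addrC.
Qed.

Definition delta h x y := h x + h y - h (x * y)%g.

Lemma factor_set_delta A h : h 1%g = 0 -> factor_set A (delta h).
Proof.
have telescope (a b c d : V) : (a - b) + (c + b - d) = a + c - d.
  by rewrite addrA [c + b]addrC addrA subrK.
move=> h1; split=> [|x y z _ _ _]; first by rewrite /delta mulg1 h1 addr0 subrr.
rewrite /delta mulgA telescope [RHS]addrC [h (_ * _)%g + h z]addrC telescope.
by congr (_ - _); rewrite addrC addrA.
Qed.

Lemma factor_setB A f g :
  factor_set A f -> factor_set A g -> factor_set A (fun x y => f x y - g x y).
Proof.
move=> [f1 fC] [g1 gC]; split=> [|x y z xA yA zA]; first by rewrite f1 g1 subrr.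
by rewrite addrACA -opprD fC // gC // opprD addrACA.
Qed.

(* Correcting [f] by the coboundary of [xy |-> hH x + hK y - f x y] makes it  *)
(* vanish on H x H, K x K and H x K, hence also on K x H by symmetry; the     *)
(* cocycle identity then forces it to vanish everywhere.                      *)
Lemma splits_dprod A H K f :
    (H \x K)%g = A -> factor_set A f -> splits H f -> splits K f ->
    {in H & K, forall x y, f x y = f y x} -> splits A f.
Proof.
case/dprodP=> _ defA cHK tiHK fA [hH hHE] [hK hKE] fsym.
have [sHA sKA] : H \subset A /\ K \subset A.
  by rewrite -defA; split; [exact: mulG_subl | exact: mulG_subr].
have hH1 := split_by1 (factor_setS sHA fA) hHE.
have hK1 := split_by1 (factor_setS sKA fA) hKE.
pose h z := let x := divgr H K z in let y := remgr H K z in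
  hH x + hK y - f x y.
have hM x y : x \in H -> y \in K -> h (x * y)%g = hH x + hK y - f x y.
  by move=> xH yK; rewrite /h divgrMid ?remgrMid.
have hHx x : x \in H -> h x = hH x.
  move=> xH; rewrite -[x in LHS]mulg1 hM // hK1.
  by rewrite (factor_set1r fA) ?(subsetP sHA) // subr0 addr0.
have hKy y : y \in K -> h y = hK y.
  move=> yK; rewrite -[y in LHS]mul1g hM // hH1.
  by rewrite (factor_set1l fA) ?(subsetP sKA) // subr0 add0r.
have h1 : h 1%g = 0 by rewrite hHx.
pose g x y := f x y - delta h x y.
have gA : factor_set A g.
  exact: factor_setB fA (factor_set_delta A h1).
have [_ gC] := gA.
have inA x : (x \in H) || (x \in K) -> x \in A.
  by case/orP; [exact: (subsetP sHA) | exact: (subsetP sKA)].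
have gHH : {in H &, forall x x1, g x x1 = 0}.
  move=> x x1 xH x1H; rewrite /g /delta !hHx ?groupM // -hHE //.
  by rewrite addrAC subrr add0r subrr.
have gKK : {in K &, forall y y1, g y y1 = 0}.
  move=> y y1 yK y1K; rewrite /g /delta !hKy ?groupM // -hKE //.
  by rewrite addrAC subrr add0r subrr.
have gHK : {in H & K, forall x y, g x y = 0}.
  move=> x y xH yK; rewrite /g /delta hM // hHx // hKy //.
  by rewrite subKr subrr.
have gKH : {in H & K, forall x y, g y x = 0}.
  move=> x y xH yK; rewrite -(gHK x y xH yK) /g /delta -fsym //.
  by rewrite (centsP cHK y yK x xH) [h y + _]addrC.
have gH_HK x x1 y : x \in H -> x1 \in H -> y \in K -> g x (x1 * y)%g = 0.
  move=> xH x1H yK; have := gC x x1 y; rewrite !inA ?xH ?x1H ?yK ?orbT //.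
  move=> /(_ isT isT isT).
  by rewrite gHK // add0r => ->; rewrite gHK ?groupM // gHH // addr0.
have gHK_K x y y1 : x \in H -> y \in K -> y1 \in K -> g (x * y)%g y1 = 0.
  move=> xH yK y1K; have := gC x y y1; rewrite !inA ?xH ?y1K ?yK ?orbT //.
  move=> /(_ isT isT isT).
  by rewrite gKK // add0r gHK ?groupM // (gHK x y) // addr0 => <-.
have gK_HK y x y1 : x \in H -> y \in K -> y1 \in K -> g y (x * y1)%g = 0.
  move=> xH yK y1K; have := gC y x y1; rewrite !inA ?xH ?y1K ?yK ?orbT //.
  move=> /(_ isT isT isT).
  rewrite gHK // add0r => ->; rewrite (gKH x y) // addr0.
  by rewrite (centsP cHK y yK x xH) gHK_K.
suff g0 : {in A &, forall u v, g u v = 0}.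
  exists h => x y xA yA; have/eqP := g0 x y xA yA.
  by rewrite subr_eq0 => /eqP->; rewrite addrC subrK.
move=> u v; rewrite -defA => /imset2P[x y xH yK ->] /imset2P[x1 y1 x1H y1K ->].
have xy1A : (x1 * y1)%g \in A by rewrite -defA mem_mulg.
(* The cocycle identity at [x], [y], [x1 * y1] reduces the general value to values with one argument
   in [H] or [K]. *)
have := gC x y _ (subsetP sHA x xH) (subsetP sKA y yK) xy1A.
rewrite (gHK x y) // addr0 => <-; rewrite gK_HK // add0r.
by rewrite mulgA (centsP cHK y yK x1 x1H) -mulgA gH_HK ?groupM.
Qed.

Definition divisible := forall (n : nat) (v : V), (0 < n)%N ->
  exists w, w *+ n = v.

(* In the extension defined by [f], the power [i] of the lift of [a] with     *)
(* coordinate 0 has coordinate [t i]; subtracting [q *+ i] with               *)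
(* [q *+ n = t n] makes the n-th power of the lift trivial.                   *)
Lemma splits_cyclic A f : divisible -> cyclic A -> factor_set A f -> splits A f.
Proof.
move=> divV /cyclicP[a defA] fA; have [f1 fC] := fA.
have aA i : (a ^+ i)%g \in A by rewrite defA mem_cycle.
pose t i := \sum_(j < i) f (a ^+ j)%g a.
have tD i j : t (i + j)%N = t i + t j + f (a ^+ i)%g (a ^+ j)%g.
  elim: j => [|j IHj].
    by rewrite addn0 expg0 (factor_set1r fA) // /t big_ord0 !addr0.
  rewrite addnS /t !big_ord_recr /= -!/(t _) {}IHj -!addrA; congr (_ + (_ + _)).
  have := fC _ _ _ (aA i) (aA j) (aA 1%N).
  by rewrite expg1 -expgD -expgSr addrC => <-; rewrite addrC.
have [q qE] := divV #[a]%g (t #[a]%g) (order_gt0 a).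
pose k i := t i - q *+ i.
have kD i j : k (i + j)%N = k i + k j + f (a ^+ i)%g (a ^+ j)%g.
  by rewrite /k tD mulrnDr opprD addrAC [t i + t j + _]addrACA.
have kn i : k (i + #[a]%g)%N = k i.
  move: (kD i #[a]%g); rewrite expg_order (factor_set1r fA) // addr0.
  by move->; rewrite [k #[a]%g]/k qE subrr addr0.
have kmod i : k (i %% #[a]%g)%N = k i.
  rewrite [in RHS](divn_eq i #[a]%g); elim: (i %/ _)%N => [|m IHm] //.
  by rewrite mulSn -addnA addnC kn.
(* Stated for every [x], with dummy exponent 0 outside [A], so that [choice] applies. *)
have idx x : exists i, x \in A -> x = (a ^+ i)%g.
  have [xA|] := boolP (x \in A); last by exists 0%N.
  by move: xA; rewrite defA => /cycleP[i ->]; exists i.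
have [e eE] := choice idx.
(* In [kD] the cocycle stands on the side opposite to that in [split_by], hence the sign. *)
exists (fun x => - k (e x)) => x y xA yA.
rewrite -opprD; apply/eqP; rewrite eq_sym eqr_oppLR opprD opprK -subr_eq0.
have -> : k (e (x * y)%g) = k (e x + e y)%N.
  rewrite -kmod -[RHS]kmod; congr k; apply/eqP.
  by rewrite -eq_expg_mod_order -eE ?groupM // expgD -!eE.
by rewrite kD -!eE // addrK subrr.
Qed.

Lemma splits_bicyclic A f :
  divisible -> bicyclic A -> factor_set A f -> commuting_sym A f -> splits A f.
Proof.
move=> divV [cA|[H [K [cH cK defA]]]] fA sym; first exact: splits_cyclic.
have [_ mulHK cHK _] := dprodP defA.
have [sHA sKA] : H \subset A /\ K \subset A.
  by rewrite -mulHK; split; [exact: mulG_subl | exact: mulG_subr].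
apply: (splits_dprod defA fA); first exact/splits_cyclic/(factor_setS sHA fA).
  exact/splits_cyclic/(factor_setS sKA fA).
move=> x y xH yK; apply: sym; [exact: (subsetP sHA) | exact: (subsetP sKA) |].
exact/esym/(centsP cHK).
Qed.

End FactorSets.

(** * Vanishing of [B0] in terms of cocycles *)

(** An abelian group on two generators has rank at most 2, so its decomposition has at most two
    cyclic factors. *)
Lemma bicyclic_gen2 (gT : finGroupType) (x y : gT) :
  commute x y -> bicyclic <<[set x; y]>>%G.
Proof.
move=> cxy; set A := <<_>>%G.
have abA : abelian A.
  rewrite abelian_gen; apply/centsP=> u /set2P[]-> v /set2P[]->; by rewrite /commute ?cxy.
have [b defA b_type] := abelian_structure abA.
have : (size b <= 2)%N.
  have <- : size (abelian_type A) = size b by rewrite -b_type size_map.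
  rewrite size_abelian_type // -grank_abelian //.
  by apply: leq_trans (grank_min _) _; rewrite cards2; case: eqP.
case: b defA {b_type} => [|u [|v []]] //=; rewrite ?big_cons big_nil ?dprodg1 => defA _.
- by left; have := cyclic1 gT; rewrite defA.
- by left; have := cycle_cyclic u; rewrite defA.
- by right; exists <[u]>%G, <[v]>%G; rewrite !cycle_cyclic.
Qed.

Lemma QmodZ_divisible : divisible QmodZ.
Proof.
move=> n v n_gt0; exists (\pi_QmodZ (repr v / n%:R))%qT.
rewrite -raddfMn; suff -> : repr v / n%:R *+ n = repr v by exact: reprK.
by rewrite -mulr_natr mulfVK // Num.Theory.pnatr_eq0 -lt0n.
Qed.

Definition sym_splits (gT : finGroupType) (V : zmodType) (A : {set gT}) :=
  forall f : gT -> gT -> V, factor_set A f -> commuting_sym A f -> splits A f.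

Section Functoriality.

Variables (aT rT : finGroupType) (V : zmodType).
Variables (A : {group aT}) (B : {group rT}) (phi : aT -> rT).
Hypotheses (phiM : {in A &, {morph phi : x y / (x * y)%g}})
           (phiB : {in A, forall x, phi x \in B}).
Variable f : rT -> rT -> V.

Lemma factor_set_comp :
  factor_set B f -> factor_set A (fun x y => f (phi x) (phi y)).
Proof.
move=> fB; have [_ fC] := fB.
split=> [|x y z xA yA zA]; last by rewrite !phiM // fC ?phiB.
suff -> : phi 1%g = 1%g by case: fB.
by apply: (@mulgI _ (phi 1%g)); rewrite -phiM ?group1 // !mulg1.
Qed.

Lemma commuting_sym_comp :
  commuting_sym B f -> commuting_sym A (fun x y => f (phi x) (phi y)).
Proof.
move=> fsym x y xA yA cxy; apply: fsym; rewrite ?phiB //.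
by rewrite /commute -!phiM // cxy.
Qed.

End Functoriality.

Lemma mem_coboundary2 (gT : finGroupType) (G : {group gT}) (F : Z2 G) :
  F \in @coboundary2 gT G <-> splits G (fun x y => Z2val F (x, y)).
Proof.
split=> [/asboolP[h hE]|[h hE]]; last apply/asboolP.
  by exists h => x y xG yG; rewrite hE // addrA [h _ + (_ - _)]addrC subrK addrC.
exists h => x y xG yG; apply: (addrI (h (x * y)%g)).
by rewrite hE // addrA [h _ + (_ - _)]addrC subrK addrC.
Qed.

Lemma Z2_of_factor_set (gT : finGroupType) (G : {group gT}) f :
  factor_set G f -> exists F : Z2 G, {in G &, forall x y, Z2val F (x, y) = f x y}.
Proof.
move=> [f1 fC].
pose F := [ffun u : gT * gT => if u \in setX G G then f u.1 u.2 else 0 : QmodZ].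
have FZ : F \in cocycle2 G.
  apply/cocycle2P; split=> [u|x y z xG yG zG]; first by rewrite ffunE => /negPf->.
  by rewrite !ffunE !in_setX !groupM ?xG ?yG ?zG //= fC.
by exists (MkZ2 FZ) => x y xG yG; rewrite ffunE in_setX xG yG.
Qed.

Lemma splits_ext (gT : finGroupType) (V : zmodType) (A : {set gT})
    (f g : gT -> gT -> V) :
  {in A &, forall x y, f x y = g x y} -> splits A f -> splits A g.
Proof. by move=> fg [h hE]; exists h => x y xA yA; rewrite -fg ?hE. Qed.

(** A symmetric cocycle splits on every bicyclic subgroup, so its class lies in [B0]. Conversely, a
    class in [B0] splits on the subgroup generated by any commuting pair, which forces symmetry
    there. *)
Lemma B0_trivialP (gT : finGroupType) (G : {group gT}) :
  B0 G = [set 0]%classic <-> sym_splits QmodZ G.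
Proof.
split=> [B0G f fG fsym | ssG].
  have [F FE] := Z2_of_factor_set fG.
  suff : (\pi_(H2 G) F)%qT == 0.
    by rewrite H2_pi_eq0 => /mem_coboundary2; apply: splits_ext.
  suff : B0 G (\pi_(H2 G) F)%qT by rewrite B0G => /= ->.
  move=> A sAG bA; have inG := subsetP sAG.
  rewrite res_pi; apply/eqP; rewrite H2_pi_eq0; apply/mem_coboundary2.
  have : splits A f.
    apply: splits_bicyclic bA _ _; first exact: QmodZ_divisible.
      exact: factor_setS fG.
    by move=> x y /inG xG /inG yG; apply: fsym.
  apply: splits_ext => x y xA yA.
  by rewrite ffunE in_setX xA yA -FE ?inG.
apply/seteqP; split=> [c cB0 | _ -> A sAG _]; last exact: raddf0.
rewrite -[c]reprK; set F := repr c; apply/eqP; rewrite H2_pi_eq0.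
apply/mem_coboundary2.
have [_ FC] := cocycle2P _ _ (Z2valP F).
(* Normalisation: a constant cocycle is the coboundary of the same constant, which is added back to
   [h] below. *)
pose f x y := Z2val F (x, y) - Z2val F (1, 1)%g.
have fG : factor_set G f.
  split=> [|x y z xG yG zG]; first exact: subrr.
  by rewrite /f [LHS]addrACA [RHS]addrACA FC.
have fsym : commuting_sym G f.
  move=> x y xG yG cxy; congr (_ - _).
  have sAG : <<[set x; y]>>%G \subset G by rewrite gen_subG subUset !sub1set xG.
  have /eqP := cB0 _ sAG (bicyclic_gen2 cxy).
  rewrite -[c]reprK res_pi H2_pi_eq0 => /mem_coboundary2[h /split_commuting_sym].
  have xA : x \in <<[set x; y]>>%G by rewrite mem_gen ?set21.
  have yA : y \in <<[set x; y]>>%G by rewrite mem_gen ?set22.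
  by move=> /(_ x y xA yA cxy); rewrite !ffunE !in_setX xA yA.
have [h hE] := ssG f fG fsym.
exists (fun x => h x + Z2val F (1, 1)%g) => x y xG yG.
by rewrite [RHS]addrACA -hE // [RHS]addrA -[_ + f x y + _]addrA subrK addrAC.
Qed.

(** Elements of different factors commute, so symmetry on commuting pairs supplies the mixed
    condition of [splits_dprod]. *)
Lemma sym_splits_setX (gT1 gT2 : finGroupType) (V : zmodType)
    (G1 : {group gT1}) (G2 : {group gT2}) :
  sym_splits V G1 -> sym_splits V G2 -> sym_splits V (setX G1 G2).
Proof.
move=> ss1 ss2 f fE fsym.
apply: (splits_dprod (setX_dprod G1 G2) fE).
- pose phi (x : gT1) : gT1 * gT2 := (x, 1%g).
  have phiM : {in G1 &, {morph phi : x y / (x * y)%g}}.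
    by move=> x y _ _; rewrite /phi -[in LHS](mulg1 1%g).
  have phiE : {in G1, forall x, phi x \in setX G1 G2}.
    by move=> x xG; rewrite in_setX xG /=.
  have [h hE] := ss1 _ (factor_set_comp phiM phiE fE)
                       (commuting_sym_comp phiM phiE fsym).
  exists (h \o fst) => -[x a] [y b]; rewrite !in_setX /=.
  by move=> /andP[xG /set1P->] /andP[yG /set1P->]; apply: hE.
- pose phi (x : gT2) : gT1 * gT2 := (1%g, x).
  have phiM : {in G2 &, {morph phi : x y / (x * y)%g}}.
    by move=> x y _ _; rewrite /phi -[in LHS](mulg1 1%g).
  have phiE : {in G2, forall x, phi x \in setX G1 G2}.
    by move=> x xG; rewrite in_setX xG group1.
  have [h hE] := ss2 _ (factor_set_comp phiM phiE fE)
                       (commuting_sym_comp phiM phiE fsym).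
  exists (h \o snd) => -[a x] [b y]; rewrite !in_setX /=.
  by move=> /andP[/set1P-> xG] /andP[/set1P-> yG]; apply: hE.
move=> [x a] [b y]; rewrite !in_setX /=.
move=> /andP[xG /set1P->] /andP[/set1P-> yG].
apply: fsym; rewrite ?in_setX ?xG ?yG ?group1 //.
by congr (_, _); rewrite /= !(mulg1, mul1g).
Qed.

(** * Extending morphisms from, and descending splittings along, a central subgroup *)

Section CentralQuotient.

Variables (gT : finGroupType) (V : zmodType) (G K : {group gT}).
Hypothesis sKZ : K \subset 'Z(G)%g.

Let sKG : K \subset G := subset_trans sKZ (center_sub G).

Let cKG a x : a \in K -> x \in G -> commute a x.
Proof. by move=> /(subsetP sKZ)/centerP[_ ca] /ca. Qed.

Let nKG : G \subset 'N(K)%g.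
Proof. exact/normal_norm/sub_center_normal. Qed.

Let sec (u : coset_of K) : gT := fingroup.repr u.

Let sec_G u : u \in (G / K)%g -> sec u \in G.
Proof.
case/morphimP=> x nKx xG ->; rewrite /sec; have := mem_repr_coset (coset K x).
by rewrite val_coset // => /rcosetP[a aK ->]; rewrite groupM // (subsetP sKG).
Qed.

Let coset_sec (u : coset_of K) : coset K (sec u) = u.
Proof. exact: coset_reprK. Qed.

Let sec1 : sec 1%g = 1%g.
Proof. exact: repr_coset1. Qed.

(** The [K]-valued factor set of the central extension [G] of [G / K], for the section [sec]. *)
Let fac (u v : coset_of K) : gT := (sec u * sec v * (sec (u * v))^-1)%g.

Let fac_K u v : u \in (G / K)%g -> v \in (G / K)%g -> fac u v \in K.
Proof.
move=> uG vG; have [uN vN] : sec u \in 'N(K)%g /\ sec v \in 'N(K)%g.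
  by split; apply: (subsetP nKG); apply: sec_G.
have uvN : sec (u * v)%g \in 'N(K)%g.
  by apply/(subsetP nKG)/sec_G/groupM.
apply: coset_idr; first by rewrite !groupM ?groupV.
rewrite morphM ?groupM ?groupV // morphV // morphM //=.
by rewrite !coset_sec mulgV.
Qed.

(** For commuting [u] and [v], [fac u v] and [fac v u] differ by a commutator in [K], which [psi]
    kills. So the pushed-out cocycle is symmetric and splits, and its splitting corrects [psi] into
    a morphism on [G]. *)
Lemma central_morph_extends (psi : gT -> V) :
    sym_splits V (G / K)%g ->
    {in K &, forall a b, psi (a * b)%g = psi a + psi b} ->
    {in G &, forall x y, [~ x, y]%g \in K -> psi [~ x, y]%g = 0} ->
  exists2 chi, {in G &, forall x y, chi (x * y)%g = chi x + chi y}
             & {in K, chi =1 psi}.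
Proof.
move=> ssGK psiM psiR.
have psi1 : psi 1%g = 0.
  by apply: (addrI (psi 1%g)); rewrite -psiM ?group1 // mulg1 addr0.
have fac1 : fac 1%g 1%g = 1%g by rewrite /fac mulg1 mulgK sec1.
have facE u v : (sec u * sec v = fac u v * sec (u * v))%g.
  by rewrite /fac mulgKV.
have gGK : factor_set (G / K)%g (fun u v => psi (fac u v)).
  split=> [|u v w uG vG wG]; first by rewrite fac1.
  rewrite -!psiM ?fac_K ?groupM //; congr psi.
  have vwE : (fac v w * fac u (v * w) * sec (u * v * w)
              = sec u * (sec v * sec w))%g.
    rewrite -(mulgA u) -mulgA -facE mulgA (cKG (fac_K vG wG) (sec_G uG)).
    by rewrite -mulgA -facE.
  have uvE : (fac (u * v) w * fac u v * sec (u * v * w)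
              = sec u * (sec v * sec w))%g.
    rewrite (cKG (fac_K (groupM uG vG) wG) (subsetP sKG _ (fac_K uG vG))).
    by rewrite -mulgA -facE mulgA -facE mulgA.
  by apply: (mulIg (sec (u * v * w)%g)); rewrite vwE uvE.
have gsym : commuting_sym (G / K)%g (fun u v => psi (fac u v)).
  move=> u v uG vG cuv; have [uG' vG'] := (sec_G uG, sec_G vG).
  have eqR : fac u v = ([~ (sec u)^-1, (sec v)^-1] * fac v u)%g.
    by rewrite /fac cuv commgEl conjgE !invgK !mulgA !mulgKV.
  have RK : [~ (sec u)^-1, (sec v)^-1]%g \in K.
    by rewrite -(mulgK (fac v u) [~ _, _]%g) -eqR groupM ?groupV ?fac_K.
  by rewrite eqR psiM ?fac_K // psiR ?groupV // add0r.
have [k kE] := ssGK _ gGK gsym.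
have k1 : k 1%g = 0 := split_by1 gGK kE.
pose chi x := psi (x * (sec (coset K x))^-1)%g + k (coset K x).
have tailK x : x \in G -> (x * (sec (coset K x))^-1)%g \in K.
  move=> xG; have xN := subsetP nKG x xG.
  rewrite -mem_rcoset -val_coset; last exact/(subsetP nKG)/sec_G/mem_quotient.
  by rewrite coset_sec val_coset // rcoset_refl.
exists chi => [x y xG yG | a aK]; last first.
  by rewrite /chi coset_id // k1 sec1 invg1 mulg1 addr0.
have [xK yK] := (mem_quotient K xG, mem_quotient K yG).
rewrite /chi morphM ?(subsetP nKG) //= [RHS]addrACA -kE // [RHS]addrCA [RHS]addrC.
have [tx ty] := (tailK x xG, tailK y yG).
(* The [K]-part of [x * y] is the product of those of [x] and [y] with the value of [fac] at their
   cosets. *)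
rewrite -(psiM _ _ tx ty) -psiM ?fac_K ?(groupM tx ty) //; congr (psi _ + _).
rewrite /fac !mulgA; congr (_ * _)%g; rewrite -!mulgA; congr (_ * _)%g.
rewrite (mulgA y) (mulgA _ (sec _)) (cKG ty) ?sec_G //.
by rewrite !mulgA mulVg mul1g mulgKV.
Qed.

Variables (f : coset_of K -> coset_of K -> V) (h : gT -> V).
Hypotheses (fGK : factor_set (G / K)%g f)
           (hE : split_by G (fun x y => f (coset K x) (coset K y)) h).

Lemma split_by_coset_mul : {in K & G, forall a x, h (a * x)%g = h a + h x}.
Proof.
move=> a x aK xG; rewrite -hE ?(subsetP sKG a aK) // coset_id //.
by rewrite (factor_set1l fGK) ?addr0 ?mem_quotient.
Qed.

(** The images of [x] and [y] commute, so symmetry gives [h (x * y) = h (y * x)], while [x * y =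
    [~ x, y] * (y * x)]. *)
Lemma split_by_coset_commg : commuting_sym (G / K)%g f ->
  {in G &, forall x y, [~ x, y]%g \in K -> h [~ x, y]%g = 0}.
Proof.
move=> fsym x y xG yG RK; have yxG := groupM yG xG; apply: (addIr (h (y * x)%g)).
rewrite -split_by_coset_mul // add0r (cKG RK yxG) -commgC.
have cxy : commute (coset K x) (coset K y).
  rewrite /commute -!morphM ?(subsetP nKG) //=.
  by rewrite commgC /= coset_kerr.
apply: (addIr (f (coset K x) (coset K y))).
by rewrite hE // fsym ?mem_quotient // hE // addrC.
Qed.

(** Subtracting a morphism from [h] gives another splitting, here constant on cosets of [K]. *)
Lemma splits_coset chi : {in G &, forall x y, chi (x * y)%g = chi x + chi y} ->
  {in K, chi =1 h} -> splits (G / K)%g f.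
Proof.
move=> chiM chiK; pose h0 x := h x - chi x.
have h0K : {in K & G, forall a x, h0 (a * x)%g = h0 x}.
  move=> a x aK xG; rewrite /h0 split_by_coset_mul // chiM ?(subsetP sKG a aK) //.
  by rewrite chiK // opprD addrACA subrr add0r.
exists (fun u => h0 (sec u)) => u v uG vG.
rewrite -(h0K (fac u v)) ?fac_K ?sec_G ?groupM // mulgKV.
rewrite /h0 chiM ?sec_G // addrAC -[u in f u _]coset_sec.
by rewrite -[v in f _ v]coset_sec hE ?sec_G // opprD addrACA.
Qed.

End CentralQuotient.

(** * The central product *)

Theorem theorem3p1 (gT1 gT2 : finGroupType)
    (G1 K1 : {group gT1}) (G2 K2 : {group gT2})
    (theta : {morphism G1 >-> gT2})
    (sK1Z : K1 \subset 'Z(G1)%g) (sK2Z : K2 \subset 'Z(G2)%g)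
    (theta_G2 : (theta @* G1)%g \subset G2)
    (theta_K : isom K1 K2 theta)
    (B0quo : B0 (G1 / K1)%G = [set 0%R]%classic)
    (B0G1 : B0 G1 = [set 0%R]%classic)
    (B0G2 : B0 G2 = [set 0%R]%classic) :
  B0 (amalgam_product G1 K1 G2 K2 theta) = [set 0%R]%classic.
Proof.
move/B0_trivialP: B0quo => ssQ; move/B0_trivialP: B0G1 => ss1.
move/B0_trivialP: B0G2 => ss2; apply/B0_trivialP.
pose N : {group gT1 * gT2} := Group (amalgam_group_set theta sK1Z sK2Z).
pose E := setX_group G1 G2.
change (sym_splits QmodZ (E / N)%g) => f fQ fsym.
have sNZ : N \subset 'Z(E)%g := amalgam_central theta sK1Z sK2Z.
have nNE : E \subset 'N(N)%g by apply/normal_norm/sub_center_normal.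
have cosetM : {in E &, {morph coset N : x y / (x * y)%g}}.
  by move=> x y xE yE; rewrite morphM ?(subsetP nNE).
have cosetQ : {in E, forall x, coset N x \in (E / N)%g}.
  by move=> x; apply: mem_quotient.
have [h hE] := sym_splits_setX ss1 ss2 (factor_set_comp cosetM cosetQ fQ)
                                      (commuting_sym_comp cosetM cosetQ fsym).
have hN := split_by_coset_mul sNZ fQ hE.
have hR := split_by_coset_commg sNZ fQ hE fsym.
have sK1G := subset_trans sK1Z (center_sub G1).
have thG x : x \in G1 -> theta x \in G2.
  by move=> xG; apply: (subsetP theta_G2); apply: mem_morphim.
have thK a : a \in K1 -> theta a \in K2.
  (* [isom] compares only the sets of nontrivial elements, so 1 is treated apart. *)
  have [-> _ | a_neq1 aK] := eqVneq a 1%g; first by rewrite morph1.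
  have /setD1P[] // : theta a \in K2^#%g.
  by rewrite -(eqP theta_K) imset_f // in_setD1 a_neq1.
pose psi a := h (a, (theta a)^-1)%g.
have aN a : a \in K1 -> (a, (theta a)^-1)%g \in N.
  by move=> aK; rewrite !inE /= aK groupV thK //= invgK.
have psiM : {in K1 &, forall a b, psi (a * b)%g = psi a + psi b}.
  move=> a b aK bK; have [aG bG] := (subsetP sK1G a aK, subsetP sK1G b bK).
  have bE := subsetP (subset_trans sNZ (center_sub E)) _ (aN b bK).
  rewrite -hN ?aN //; congr (h (_, _)).
  (* Inversion reverses the product; centrality of [theta b] restores the order. *)
  have /centerP[_ cb] := subsetP sK2Z _ (thK b bK).
  by rewrite morphM // -cb ?thG // invMg.
have psiR : {in G1 &, forall x y, [~ x, y]%g \in K1 -> psi [~ x, y]%g = 0}.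
  move=> x y xG yG RK.
  (* Exchanging [x] and [y] in the second coordinate inverts the commutator, as membership in [N]
     demands. *)
  have eqR : ([~ x, y], (theta [~ x, y])^-1)%g = [~ (x, theta y), (y, theta x)]%g.
    by congr (_, _); rewrite /= morphR // invg_comm.
  rewrite /psi eqR hR ?in_setX ?xG ?yG ?thG // -eqR; exact: aN.
have [chi chiM chiK] := central_morph_extends sK1Z ssQ psiM psiR.
apply: (splits_coset sNZ fQ hE (chi := chi \o fst)) => [[x a] [y b]|[a b]].
  by rewrite !in_setX /= => /andP[xG _] /andP[yG _]; apply: chiM.
rewrite inE in_setX /= => /andP[/andP[aK _] /eqP thab].
by rewrite chiK // /psi thab invgK.
Qed.
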